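(* Let $n\ge 1$ and $\mathbf{w}=(w_1,\dots,w_n)\in\mathbb{Z}_{\ge 0}^n$. The chutewise dominance order $\le_{\mathbf{c}}$ on $\mathbf{P}(\mathbf{w})$ coincides with the geometric partial order $\le_{\mathbf{g}}$ on $\mathbf{P}(\mathbf{w})$; that is, for all $Y,Y'\in\mathbf{P}(\mathbf{w})$ one has $Y\le_{\mathbf{c}}Y'$ if and only if $\mathcal{O}_Y\subset\overline{\mathcal{O}_{Y'}}$.
   Context: $\mathbf{P}(\mathbf{w})$ is the set of triangular arrays $Y=(y_{ij})_{1\le i\le n,\,1\le j\le n-i+1}$ of nonnegative integers with $\sum_{j=1}^{n-i+1}y_{ij}=w_i$ for all $i$ and $y_{ij}\ge y_{i-1,j+1}$ for all $i\ge 2$ and all $j$. Chutewise dominance order: for $Y=(y_{ij})$, $Y'=(y'_{ij})$ in $\mathbf{P}(\mathbf{w})$, $Y\le_{\mathbf{c}}Y'$ means $\sum_{k=1}^j y_{ik}\ge\sum_{k=1}^j y'_{ik}$ for all $i$ and $j$. Orbits: $E(\mathbf{w})=\prod_{i=1}^{n-1}\mathrm{Hom}(\mathbb{C}^{w_i},\mathbb{C}^{w_{i+1}})$ is the space of representations $x=(x_1,\dots,x_{n-1})$ of the equioriented quiver $\bullet\to\bullet\to\cdots\to\bullet$ with $n$ vertices; $G(\mathbf{w})=\prod_{i=1}^n\mathrm{GL}(w_i)$ acts by $(g_i)\cdot(x_i)=(g_{i+1}x_ig_i^{-1})$. For $x\in E(\mathbf{w})$, $M(x)$ denotes the corresponding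 quiver representation. For $1\le i\le j\le n$, $R_{ij}$ is the indecomposable representation with $\mathbb{C}$ at vertices $i,\dots,j$, zero elsewhere, and identity maps between consecutive copies of $\mathbb{C}$. For $Y\in\mathbf{P}(\mathbf{w})$ put $\nu(Y)_{ij}=y_{i,j-i+1}-y_{i-1,j-i+2}$ for $1\le i\le j\le n$ (the second term is $0$ if $i=1$). Then $\mathcal{O}_Y\subset E(\mathbf{w})$ is the $G(\mathbf{w})$-orbit of those $x$ with $M(x)\cong\bigoplus_{i\le j}R_{ij}^{\oplus\nu(Y)_{ij}}$; $Y\mapsto\mathcal{O}_Y$ is a bijection from $\mathbf{P}(\mathbf{w})$ to the set of $G(\mathbf{w})$-orbits. Geometric order: $Y\le_{\mathbf{g}}Y'$ means $\mathcal{O}_Y\subset\overline{\mathcal{O}_{Y'}}$. *)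

(* Defs.v *)
(* Mathematical Components, with R[i] for R : realType as the complex field. *)
From HB Require Import structures.
From mathcomp Require Import all_boot all_order all_algebra.
From mathcomp Require Import classical_sets reals complex mpoly.

Set Implicit Arguments.
Unset Strict Implicit.
Unset Printing Implicit Defensive.

Import GRing.Theory.

Local Open Scope ring_scope.

(* Vertices, rows and columns are numbered from 1. A dimension vector is a
   function nat -> nat of which only the values at 1, ..., n are ever used. *)

Definition in_triangle (n i j : nat) : bool :=
  [&& 1 <= i, 1 <= j & i + j <= n.+1]%N.

(* The set P(w). Entries are 0 outside the triangle, so that equality of arrays
   only concerns their actual entries. *)
Record tri_array (n : nat) (w : nat -> nat) := TriArray {
  entry :> nat -> nat -> nat;
  entry_out : forall i j, ~~ in_triangle n i j -> entry i j = 0%N;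
  entry_sum : forall i, (1 <= i <= n)%N ->
    (\sum_(1 <= j < (n - i + 1).+1) entry i j)%N = w i;
  entry_diag : forall i j, (2 <= i)%N -> in_triangle n i j ->
    (entry i.-1 j.+1 <= entry i j)%N
}.

(* The chutewise dominance order; note the reversal. *)
Definition chute_le (n : nat) (w : nat -> nat) (Y Y' : tri_array n w) : Prop :=
  forall i j, in_triangle n i j ->
    (\sum_(1 <= k < j.+1) Y' i k <= \sum_(1 <= k < j.+1) Y i k)%N.

(* The arrow a : 'I_n.-1 goes from vertex a.+1 to vertex a.+2; matrices act on
   column vectors. *)
Definition rep_space (K : fieldType) (n : nat) (w : nat -> nat) : Type :=
  forall a : 'I_n.-1, 'M[K]_(w a.+2, w a.+1).

Record quiver_rep (K : fieldType) (n : nat) := QuiverRep {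
  qdim : nat -> nat;
  qmap : rep_space K n qdim
}.

Definition quiver_iso (K : fieldType) (n : nat) (M N : quiver_rep K n) : Prop :=
  exists (f : forall i, 'M[K]_(qdim N i, qdim M i))
         (g : forall i, 'M[K]_(qdim M i, qdim N i)),
    (forall i, (1 <= i <= n)%N -> f i *m g i = 1%:M /\ g i *m f i = 1%:M) /\
    (forall a : 'I_n.-1, f a.+2 *m qmap M a = qmap N a *m f a.+1).

Definition quiver_zero (K : fieldType) (n : nat) : quiver_rep K n :=
  @QuiverRep K n (fun=> 0%N) (fun=> 0).

Definition quiver_dsum (K : fieldType) (n : nat) (M N : quiver_rep K n) :
    quiver_rep K n :=
  @QuiverRep K n (fun i => (qdim M i + qdim N i)%N)
    (fun a => block_mx (qmap M a) 0 0 (qmap N a)).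

(* The representation R_ij. Its matrices have at most one row and one column,
   so const_mx 1 is the identity between two copies of K and is empty
   otherwise. *)
Definition quiver_ind (K : fieldType) (n i j : nat) : quiver_rep K n :=
  @QuiverRep K n (fun k => nat_of_bool (i <= k <= j)%N) (fun=> const_mx 1).

(* Subtraction does not truncate on the range 1 <= i <= j <= n (entry_diag);
   for i = 1 the second term is 0 because row 0 is outside the triangle. *)
Definition nu (n : nat) (w : nat -> nat) (Y : tri_array n w) (i j : nat) : nat :=
  (Y i (j - i + 1) - Y i.-1 (j - i + 2))%N.

Definition model_rep (K : fieldType) (n : nat) (w : nat -> nat)
    (Y : tri_array n w) : quiver_rep K n :=
  \big[@quiver_dsum K n/quiver_zero K n]_(1 <= i < n.+1)
    \big[@quiver_dsum K n/quiver_zero K n]_(i <= j < n.+1)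
      \big[@quiver_dsum K n/quiver_zero K n]_(k < nu Y i j) quiver_ind K n i j.

Definition orbit_of (K : fieldType) (n : nat) (w : nat -> nat)
    (Y : tri_array n w) : set (rep_space K n w) :=
  [set x | quiver_iso (QuiverRep x) (model_rep K Y)]%classic.

Arguments orbit_of K {n w} Y _.

Definition in_group (K : fieldType) (n : nat) (w : nat -> nat)
    (g : forall i, 'M[K]_(w i)) : Prop :=
  forall i, (1 <= i <= n)%N -> g i \in unitmx.

Definition group_act (K : fieldType) (n : nat) (w : nat -> nat)
    (g : forall i, 'M[K]_(w i)) (x : rep_space K n w) : rep_space K n w :=
  fun a => g a.+2 *m x a *m invmx (g a.+1).

Lemma quiver_iso_trans (K : fieldType) (n : nat) (M N P : quiver_rep K n) :
  quiver_iso M N -> quiver_iso N P -> quiver_iso M P.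
Proof.
move=> [f [g [fg fE]]] [f' [g' [fg' fE']]].
exists (fun i => f' i *m f i), (fun i => g i *m g' i); split=> [i hi|a].
  have [h1 h2] := fg _ hi; have [h3 h4] := fg' _ hi; split.
    by rewrite mulmxA -(mulmxA (f' i)) h1 mulmx1.
  by rewrite mulmxA -(mulmxA (g i)) h4 mulmx1.
by rewrite -mulmxA fE mulmxA fE' mulmxA.
Qed.

Lemma arrow_source (n : nat) (a : 'I_n.-1) : (1 <= a.+1 <= n)%N.
Proof. by case: n a => [|n] [a ha] //=; apply: ltnW. Qed.

Lemma arrow_target (n : nat) (a : 'I_n.-1) : (1 <= a.+2 <= n)%N.
Proof. by case: n a => [|n] [a ha]. Qed.

Lemma quiver_iso_sym (K : fieldType) (n : nat) (M N : quiver_rep K n) :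
  quiver_iso M N -> quiver_iso N M.
Proof.
move=> [f [g [fg fE]]]; exists g, f; split=> [i /fg[] //|a].
have [h1 _] := fg _ (arrow_source a); have [_ h2] := fg _ (arrow_target a).
rewrite -[LHS]mulmx1 -h1 mulmxA -(mulmxA (g a.+2)) -fE.
by rewrite (mulmxA (g a.+2)) h2 mul1mx.
Qed.

Lemma quiver_iso_act (K : fieldType) (n : nat) (w : nat -> nat)
    (x y : rep_space K n w) :
  quiver_iso (QuiverRep x) (QuiverRep y) <->
  exists2 g : forall i, 'M[K]_(w i), in_group n g & forall a, y a = group_act g x a.
Proof.
split=> [[f [g /= [fg fE]]]|[g hg gE]].
  have fU : in_group n f by move=> i /fg[/mulmx1_unit[]].
  exists f => // a; rewrite /group_act fE mulmxK //.
  exact/fU/arrow_source.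
exists g, (fun i => invmx (g i)); split=> /= [i hi|a].
  by rewrite mulmxV ?mulVmx ?hg.
by rewrite gE /group_act mulmxKV // hg // arrow_source.
Qed.

Lemma orbit_ofP (K : fieldType) (n : nat) (w : nat -> nat) (Y : tri_array n w)
    (x y : rep_space K n w) :
  orbit_of K Y x ->
  orbit_of K Y y <->
  exists2 g : forall i, 'M[K]_(w i), in_group n g & forall a, y a = group_act g x a.
Proof.
rewrite -quiver_iso_act => xY; split=> [/quiver_iso_sym|/quiver_iso_sym xy].
  exact: quiver_iso_trans.
exact: quiver_iso_trans xY.
Qed.

(* The coordinates on rep_space: matrix positions on each arrow. *)
Definition coord_type (n : nat) (w : nat -> nat) : finType :=
  {a : 'I_n.-1 & ('I_(w a.+2) * 'I_(w a.+1))%type}.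

Definition coord (K : fieldType) (n : nat) (w : nat -> nat)
    (x : rep_space K n w) (c : coord_type n w) : K :=
  x (tag c) (tagged c).1 (tagged c).2.

Definition zariski_closed (K : fieldType) (n : nat) (w : nat -> nat)
    (Z : set (rep_space K n w)) : Prop :=
  exists I : set {mpoly K[#|coord_type n w|]},
    Z = [set x | forall p, I p -> p.@[fun k => coord x (enum_val k)] = 0]%classic.

Definition zariski_closure (K : fieldType) (n : nat) (w : nat -> nat)
    (S : set (rep_space K n w)) : set (rep_space K n w) :=
  smallest (@zariski_closed K n w) S.

(* Over the complex numbers the Euclidean closure of an orbit is the same set,
   since orbits are constructible. *)
Definition geom_le (K : fieldType) (n : nat) (w : nat -> nat)
    (Y Y' : tri_array n w) : Prop :=
  (orbit_of K Y `<=` zariski_closure (orbit_of K Y'))%classic.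

Arguments geom_le K {n w} Y Y'.

(* Main.v *)
Require Import Defs.
From mathcomp Require Import all_boot all_order all_algebra.
From mathcomp Require Import zify.
From mathcomp Require Import classical_sets reals complex mpoly.

(** Both orders are compared with a third one, given by path ranks. For a
    representation [M] and vertices [a <= b] let [rk M a b] be the rank of the
    composite map from vertex [a] to vertex [b]. On the orbit of [Y] it equals
    [w a] minus a partial sum of row [a] of [Y] ([rk_model]), so the chutewise
    order says that all path ranks of [Y] are at most those of [Y']
    ([chute_le_rk]).

    A bound on a path rank is a closed condition, so containment in an orbit
    closure implies the rank inequalities ([rk_le_of_geom_le]).

    For the converse, path ranks classify representations up to isomorphism
    ([quiver_iso_of_rk]): the first nonzero vertex [i] and the last vertex [j]
    reached from it determine an interval [R_ij] that splits off. If the path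
    ranks of [M] are at most those of [N], split such an interval off [N], as
    [N = R_ij + N'], and look in [M] for a subrepresentation [S] with one
    vector at each of the vertices [i, ..., j] such that the path ranks of
    [M / S] are at most those of [N'] ([line_subrep]). Such an [S] exists: at
    each vertex [k] its vector only has to lie in the images of the paths whose
    rank already equals that of [N], and a greedy choice of segments achieves
    this ([first_rank_drop]). Inductively [M / S] and [N'] are points of a line
    of representations whose path ranks are bounded by those of [N']; adding a
    triangular block for [S] and [R_ij] gives a line through [M] and [N] whose
    path ranks are bounded by those of [N] ([degenerates_of_rk_le]).

    On that line the path ranks are equal to those of [N] at all but finitely
    many points, by semicontinuity, and these points lie in the orbit of [N] by
    the classification. A polynomial vanishing on the orbit thus vanishes on
    the whole line, in particular at [M] ([geom_le_of_rk_le]). *)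

Set Implicit Arguments.
Unset Strict Implicit.
Unset Printing Implicit Defensive.

Import Order.TTheory GRing.Theory Num.Theory.

Local Open Scope ring_scope.

(** * Linear algebra *)

(** Case analysis on a boolean that occurs in a matrix dimension: `boolP' would
    abstract the boolean and break typing, this disjunction leaves it in place. *)
Lemma true_or_false (b : bool) : b \/ b = false.
Proof. by case: b; [left|right]. Qed.

Section LinearAlgebra.

Variable K : fieldType.

Lemma eq_mx_nrows0 m p (A B : 'M[K]_(m, p)) : m = 0%N -> A = B.
Proof. by move=> m0; move: A B; rewrite m0 => A B; rewrite !flatmx0. Qed.

Lemma eq_mx_ncols0 m p (A B : 'M[K]_(m, p)) : p = 0%N -> A = B.
Proof. by move=> p0; move: A B; rewrite p0 => A B; rewrite !thinmx0. Qed.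

(** Used to turn a drop of rank along an arrow into an actual vector that
    survives up to the source of the arrow and dies at its target. *)
Lemma rank_drop_kernel m p q (B : 'M[K]_(q, m)) (A : 'M[K]_(m, p)) :
  (\rank (B *m A) < \rank A)%N ->
  exists2 z : 'cV[K]_p, A *m z != 0 & B *m A *m z = 0.
Proof.
move=> lt_rk; pose C := kermx (B *m A)^T.
have /matrix0Pn [i [j ij]] : C *m A^T != 0.
  apply/negP=> /eqP /sub_kermxP /mxrankS.
  rewrite !mxrank_ker !mxrank_tr.
  have := rank_leq_col A; have := rank_leq_col (B *m A); lia.
exists (row i C)^T.
  apply/matrix0Pn; exists j, 0.
  by rewrite -[X in X *m _]trmxK -trmx_mul -row_mul [_^T _ _]mxE [row _ _ _ _]mxE.
apply: trmx_inj; rewrite trmx_mul trmxK trmx0 -row_mul.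
by rewrite mulmx_ker row0.
Qed.

(** If the ranks agreed, the row spaces of [A] and [B *m A] would be equal, so
    that [A] would kill every vector killed by [B *m A]. *)
Lemma kernel_rank_drop m p q (B : 'M[K]_(q, m)) (A : 'M[K]_(m, p)) (z : 'cV[K]_p) :
  A *m z != 0 -> B *m A *m z = 0 -> (\rank (B *m A) < \rank A)%N.
Proof.
move=> Az BAz; apply: rank_ltmx; rewrite ltmxE submxMl /=.
apply/negP=> /submxP [D AE]; move: Az; rewrite AE -mulmxA BAz mulmx0.
by rewrite eqxx.
Qed.

Lemma mulVpmx_cV m (u : 'cV[K]_m) : u != 0 -> pinvmx u *m u = 1%:M.
Proof.
move=> u0; apply: mulVpmx; rewrite /row_full -mxrank_tr rank_rV.
by rewrite -(inj_eq trmx_inj) trmxK trmx0 u0.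
Qed.

Lemma const_mx1_mul_bool (b : bool) :
  (const_mx 1 : 'M[K]_(b, 1)) *m (const_mx 1 : 'M_(1, b)) = 1%:M.
Proof.
case: b; last exact: eq_mx_nrows0.
by apply/matrixP=> i j; rewrite !mxE big_ord1 !mxE !ord1 mulr1.
Qed.

(* A left inverse [phi] of [v] makes [1 - v *m phi] a projection with kernel
   the image of [v]; factoring it through its rank, as a column base times a
   row base, gives mutually inverse coordinates on a complement. *)

Section Complement.

Variables (m c : nat) (v : 'M[K]_(m, c)) (phi : 'M[K]_(c, m)).
Hypothesis phiv : phi *m v = 1%:M.

Definition compl_proj : 'M[K]_(\rank (1%:M - v *m phi), m) :=
  row_base (1%:M - v *m phi).
Definition compl_inj : 'M[K]_(m, \rank (1%:M - v *m phi)) :=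
  col_base (1%:M - v *m phi).

Let projF : row_free compl_proj. Proof. exact: row_base_free. Qed.
Let injF : row_full compl_inj. Proof. exact: col_base_full. Qed.

Lemma compl_inj_proj : compl_inj *m compl_proj = 1%:M - v *m phi.
Proof. exact: mulmx_base. Qed.

Lemma compl_proj0 : compl_proj *m v = 0.
Proof.
apply: (row_full_inj injF); rewrite mulmxA compl_inj_proj mulmx0.
by rewrite mulmxBl mul1mx -mulmxA phiv mulmx1 subrr.
Qed.

Lemma compl_inj0 : phi *m compl_inj = 0.
Proof.
apply: (row_free_inj projF); rewrite -mulmxA compl_inj_proj mul0mx.
by rewrite mulmxBr mulmx1 mulmxA phiv mul1mx subrr.
Qed.

Lemma compl_proj_inj : compl_proj *m compl_inj = 1%:M.
Proof.
apply: (row_full_inj injF); rewrite mulmxA compl_inj_proj mulmx1.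
by rewrite mulmxBl mul1mx -mulmxA compl_inj0 mulmx0 subr0.
Qed.

End Complement.

End LinearAlgebra.

(** * Path ranks of a representation *)

Section Paths.

Variables (K : fieldType) (n : nat).
Implicit Types M N : quiver_rep K n.

(** Arrows indexed by natural numbers, and equal to 0 off the quiver. The zero
    arrow leaving the last vertex saves a special case for intervals that
    end there. *)
Definition arr M k : 'M[K]_(qdim M k.+1, qdim M k) :=
  match k return 'M[K]_(qdim M k.+1, qdim M k) with
  | 0 => 0
  | a.+1 => match (a < n.-1)%N =P true with
            | ReflectT h => qmap M (Ordinal h)
            | ReflectF _ => 0
            end
  end.

Lemma arrE M (a : 'I_n.-1) : arr M a.+1 = qmap M a.
Proof.
case: a => a ha /=; case: eqP => [h|//].
by rewrite (bool_irrelevance h ha).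
Qed.

Lemma arrow_of k : (0 < k < n)%N -> exists a : 'I_n.-1, k = a.+1.
Proof.
case: k => [//|k] /= hk; have hk' : (k < n.-1)%N by lia.
by exists (Ordinal hk').
Qed.

Lemma arr_out M k : (n <= k)%N -> arr M k = 0.
Proof. by case: k => [//|k] nk /=; case: eqP => // h; lia. Qed.

(** The composite map from vertex [i] to vertex [k]. At [k = i] the matrix
    [pid_mx] is the identity, and it has the required type without a cast. *)
Fixpoint qpath M i k : 'M[K]_(qdim M k, qdim M i) :=
  match k return 'M[K]_(qdim M k, qdim M i) with
  | 0 => if i == 0%N then pid_mx (qdim M i) else 0
  | k'.+1 => if i == k'.+1 then pid_mx (qdim M i) else arr M k' *m qpath M i k'
  end.

Lemma qpath_id M i : qpath M i i = 1%:M.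
Proof. by case: i => [|i] /=; rewrite ?eqxx pid_mx_1. Qed.

Lemma qpathS M i k : (i <= k)%N -> qpath M i k.+1 = arr M k *m qpath M i k.
Proof. by move=> ik /=; rewrite ltn_eqF. Qed.

Lemma qpath_trans M i j k : (i <= j <= k)%N ->
  qpath M i k = qpath M j k *m qpath M i j.
Proof.
elim: k => [|k IH] /andP[ij jk].
  have -> : j = 0%N by lia.
  by rewrite qpath_id mul1mx.
move: jk; rewrite leq_eqVlt => /predU1P[->|jk]; first by rewrite qpath_id mul1mx.
by rewrite qpathS 1?(qpathS _ (k := k)) ?IH ?mulmxA //; lia.
Qed.

Definition rk M i k : nat := \rank (qpath M i k).

Lemma rk_id M i : rk M i i = qdim M i.
Proof. by rewrite /rk qpath_id mxrank1. Qed.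

Lemma rkS M i k : (i <= k)%N -> (rk M i k.+1 <= rk M i k)%N.
Proof. by move=> ik; rewrite /rk qpathS // mxrankM_maxr. Qed.

Lemma rk_out M i : (i <= n)%N -> rk M i n.+1 = 0%N.
Proof. by move=> i_n; rewrite /rk qpathS // arr_out // mul0mx mxrank0. Qed.

Lemma qpath_morphism M N (f : forall i, 'M[K]_(qdim N i, qdim M i)) i k :
  (forall a : 'I_n.-1, f a.+2 *m qmap M a = qmap N a *m f a.+1) ->
  (0 < i)%N -> (i <= k <= n)%N -> f k *m qpath M i k = qpath N i k *m f i.
Proof.
move=> fE i0; elim: k => [|k IH] ikn; first lia.
have [->|ik] : i = k.+1 \/ (i <= k)%N by lia.
  by rewrite !qpath_id mulmx1 mul1mx.
have [|a ka] := @arrow_of k; first lia.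
rewrite !qpathS // mulmxA -[in RHS]mulmxA -IH ?mulmxA; last lia.
by subst k; rewrite !arrE fE.
Qed.

Lemma rk_iso M N i k : quiver_iso M N -> (0 < i)%N -> (i <= k <= n)%N ->
  rk M i k = rk N i k.
Proof.
move=> MN i0 ikn; apply/eqP; rewrite eqn_leq.
suff le_rk M' N' : quiver_iso M' N' -> (rk M' i k <= rk N' i k)%N.
  by rewrite !le_rk //; apply: quiver_iso_sym.
case=> f [g [fg fE]].
have [_ gf] : f k *m g k = 1%:M /\ g k *m f k = 1%:M by apply: fg; lia.
rewrite /rk -[qpath M' i k]mul1mx -gf -mulmxA (qpath_morphism fE) //.
exact: leq_trans (mxrankM_maxr _ _) (mxrankM_maxl _ _).
Qed.

Lemma quiver_iso_dim0 M N :
  (forall k, (0 < k <= n)%N -> qdim M k = 0%N) ->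
  (forall k, (0 < k <= n)%N -> qdim N k = 0%N) -> quiver_iso M N.
Proof.
move=> M0 N0; exists (fun=> 0), (fun=> 0); split=> [k hk|a].
  by split; apply: eq_mx_nrows0; rewrite ?M0 ?N0.
by rewrite mul0mx mulmx0.
Qed.

Lemma qpath_dsum M N i k : (i <= k)%N ->
  qpath (quiver_dsum M N) i k = block_mx (qpath M i k) 0 0 (qpath N i k).
Proof.
elim: k => [|k IH] ik.
  have -> : i = 0%N by lia.
  by rewrite !qpath_id -scalar_mx_block.
have [->|{}ik] : i = k.+1 \/ (i <= k)%N by lia.
  by rewrite !qpath_id -scalar_mx_block.
have -> : qpath (quiver_dsum M N) i k.+1 =
    block_mx (arr M k) 0 0 (arr N k) *m block_mx (qpath M i k) 0 0 (qpath N i k).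
  rewrite qpathS // IH //; congr (_ *m _).
  case: (k) => [|a] /=; first by rewrite block_mx0.
  by case: eqP => //= _; rewrite block_mx0.
by rewrite !qpathS // mulmx_block !mul0mx !mulmx0 !addr0 !add0r.
Qed.

Lemma rk_dsum M N i k : (i <= k)%N ->
  rk (quiver_dsum M N) i k = (rk M i k + rk N i k)%N.
Proof. by move=> ik; rewrite /rk qpath_dsum // rank_diag_block_mx. Qed.

Lemma rk_zero i k : rk (quiver_zero K n) i k = 0%N.
Proof. by apply/eqP; rewrite /rk -leqn0 rank_leq_row. Qed.

Lemma rk_ind i j a b : (0 < a)%N -> (a <= b <= n)%N ->
  rk (quiver_ind K n i j) a b = ((i <= a)%N && (b <= j)%N).
Proof.
move=> a0; elim: b => [|b IH] abn; first lia.
have [->|ab] : a = b.+1 \/ (a <= b)%N by lia.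
  by rewrite rk_id.
have [hij|hij] := boolP ((i <= a)%N && (b.+1 <= j)%N); last first.
  apply/eqP; rewrite -leqn0 /=.
  have [bj|bj] := boolP (i <= b.+1 <= j)%N.
    have := rkS (quiver_ind K n i j) ab; rewrite IH; lia.
  by apply: (leq_trans (rank_leq_row _)); rewrite /= (negbTE bj).
have qE k : (a <= k <= b.+1)%N -> qpath (quiver_ind K n i j) a k = const_mx 1.
  elim: k => [|k IHk] akb; first lia.
  have [<-|ak] : a = k.+1 \/ (a <= k)%N by lia.
    rewrite qpath_id; apply/matrixP=> -[r hr] -[c hc]; rewrite !mxE.
    have rc : r == c by move: hr hc => /=; lia.
    by rewrite -val_eqE /= rc.
  have [|e ke] := @arrow_of k; first lia.
  rewrite qpathS // IHk; last lia.
  subst k; rewrite arrE /=; apply/matrixP=> r c; rewrite !mxE.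
  rewrite (eq_bigr (fun=> 1)) => [|d _]; last by rewrite !mxE mulr1.
  rewrite sumr_const card_ord /=.
  by have -> : (i <= e.+1 <= j)%N by lia.
rewrite /rk qE; last lia.
apply/eqP; rewrite eqn_leq; apply/andP; split.
  exact: leq_trans (rank_leq_row _) (leq_b1 _).
rewrite lt0n mxrank_eq0; apply/matrix0Pn.
have h1 : (0 < (i <= b.+1 <= j)%N)%N by lia.
have h2 : (0 < (i <= a <= j)%N)%N by lia.
by exists (Ordinal h1), (Ordinal h2); rewrite mxE oner_eq0.
Qed.

End Paths.

(** * Splitting off an interval and classification by path ranks *)

Section Splitting.

Variables (K : fieldType) (n : nat).
Implicit Types M N : quiver_rep K n.

(** Vertexwise splittings [v], [phi] with complementary coordinates [p], [q]
    put [M] in block form. The block [p x v] vanishes when the images of the [v]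
    form a subrepresentation, and then the block [p x q] is the quotient; when
    [phi x q] vanishes too, the subrepresentation is a direct summand. *)
Lemma quiver_split M (c : nat -> nat) (v : forall k, 'M[K]_(qdim M k, c k))
    (phi : forall k, 'M[K]_(c k, qdim M k)) :
    (forall k, (0 < k <= n)%N -> phi k *m v k = 1%:M) ->
  exists d (p : forall k, 'M[K]_(d k, qdim M k)) (q : forall k, 'M[K]_(qdim M k, d k)),
    (forall k, (0 < k <= n)%N ->
       [/\ q k *m p k = 1%:M - v k *m phi k, p k *m q k = 1%:M,
           p k *m v k = 0 & phi k *m q k = 0]) /\
    quiver_iso M (@QuiverRep K n (fun k => c k + d k)%N (fun a =>
      block_mx (phi a.+2 *m qmap M a *m v a.+1) (phi a.+2 *m qmap M a *m q a.+1)
               (p a.+2 *m qmap M a *m v a.+1) (p a.+2 *m qmap M a *m q a.+1))).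
Proof.
move=> phiv; exists (fun k => \rank (1%:M - v k *m phi k)).
exists (fun k => compl_proj (v k) (phi k)), (fun k => compl_inj (v k) (phi k)).
split=> [k /phiv h|].
  by rewrite compl_inj_proj compl_proj_inj ?compl_proj0 ?compl_inj0.
exists (fun k => col_mx (phi k) (compl_proj (v k) (phi k))).
exists (fun k => row_mx (v k) (compl_inj (v k) (phi k))).
have gf k : row_mx (v k) (compl_inj (v k) (phi k)) *m
            col_mx (phi k) (compl_proj (v k) (phi k)) = 1%:M.
  by rewrite mul_row_col compl_inj_proj addrC subrK.
split=> [k /phiv h|a] /=.
  rewrite gf mul_col_row h compl_proj0 // compl_inj0 // compl_proj_inj //.
  by rewrite -scalar_mx_block.
by rewrite -mul_col_row -mul_col_mx -[RHS]mulmxA gf mulmx1.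
Qed.

(** In a product of the maps [p x q] the inner factors [q *m p] may be replaced
    by the identity: the defect [v *m phi] is killed by the next [p x]. *)
Lemma qpath_quotient M d (p : forall k, 'M[K]_(d k, qdim M k))
    (q : forall k, 'M[K]_(qdim M k, d k)) c (v : forall k, 'M[K]_(qdim M k, c k))
    (phi : forall k, 'M[K]_(c k, qdim M k)) i k :
    (forall k, (0 < k <= n)%N ->
       q k *m p k = 1%:M - v k *m phi k /\ p k *m q k = 1%:M) ->
    (forall k, (0 < k < n)%N -> p k.+1 *m arr M k *m v k = 0) ->
    (0 < i)%N -> (i <= k <= n)%N ->
  qpath (@QuiverRep K n d (fun a => p a.+2 *m qmap M a *m q a.+1)) i k =
  p k *m qpath M i k *m q i.
Proof.
move=> qp pxv i0; elim: k => [|k IH] ikn; first lia.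
have [ik|ik] : i = k.+1 \/ (i <= k)%N by lia.
  by subst i; rewrite !qpath_id mulmx1; have [|_ ->] := qp k.+1; [lia|].
rewrite !qpathS // IH; last lia.
have -> : arr (@QuiverRep K n d (fun a => p a.+2 *m qmap M a *m q a.+1)) k =
    p k.+1 *m arr M k *m q k.
  have [|a ka] := @arrow_of n k; first lia.
  by subst k; rewrite !arrE.
rewrite -!mulmxA (mulmxA (q k)); have [|-> _] := qp k; first lia.
rewrite mulmxBl mul1mx !mulmxBr !mulmxA pxv; last lia.
by rewrite !mul0mx subr0.
Qed.

(** Vectors [u k] at the vertices [i, ..., j] are matrices with one column
    there and no column elsewhere, so that the dimensions fit those of the
    interval representation; dually for linear forms. *)
Definition line_in (i j : nat) M (u : forall k, 'cV[K]_(qdim M k)) k :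
    'M[K]_(qdim M k, (i <= k <= j)%N) := u k *m const_mx 1.
Definition line_on (i j : nat) M (phi : forall k, 'rV[K]_(qdim M k)) k :
    'M[K]_((i <= k <= j)%N, qdim M k) := const_mx 1 *m phi k.

Lemma line_onK i j M (u : forall k, 'cV[K]_(qdim M k)) (phi : forall k, 'rV[K]_(qdim M k)) k :
  ((i <= k <= j)%N -> phi k *m u k = 1%:M) ->
  line_on i j phi k *m line_in i j u k = 1%:M.
Proof.
rewrite /line_in /line_on => h; rewrite -mulmxA (mulmxA (phi k)).
have [ikj|/negbTE ikj] := boolP (i <= k <= j)%N; last by apply: eq_mx_nrows0.
by rewrite h // mul1mx const_mx1_mul_bool.
Qed.

(** Take [z] at vertex [i] that survives up to [j] and dies at [j.+1]. Its images
    span a copy of the interval. A linear form at [j] that is 1 on the image of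
    [z], pulled back to the vertices [i, ..., j], retracts onto that copy; this
    retraction is compatible with the arrow entering [i] because [M] vanishes
    before [i]. *)
Lemma split_first M i j : (0 < i)%N -> (i <= j <= n)%N ->
    (forall k, (0 < k < i)%N -> qdim M k = 0%N) ->
    (0 < rk M i j)%N -> rk M i j.+1 = 0%N ->
  exists M', quiver_iso M (quiver_dsum (quiver_ind K n i j) M').
Proof.
move=> i0 ijn M0 rk_ij rk_ij1.
have ij : (i <= j)%N by lia.
have Pj1 : qpath M i j.+1 = 0.
  by apply/eqP; rewrite -mxrank_eq0; apply/eqP.
have [z zj zj1] : exists2 z : 'cV_(qdim M i), qpath M i j *m z != 0 &
    arr M j *m qpath M i j *m z = 0.
  by apply: rank_drop_kernel; rewrite -qpathS // -!/(rk _ _ _) rk_ij1.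
have [u [uS uj1 [phi phiS phiu]]] : exists u : forall k, 'cV[K]_(qdim M k),
    [/\ forall k, (i <= k)%N -> arr M k *m u k = u k.+1, u j.+1 = 0 &
     exists2 phi : forall k, 'rV[K]_(qdim M k),
      forall k, (k < j)%N -> phi k.+1 *m arr M k = phi k &
      forall k, (i <= k <= j)%N -> phi k *m u k = 1%:M].
  exists (fun k => qpath M i k *m z); split=> [k ik||].
  - by rewrite mulmxA -qpathS.
  - by rewrite Pj1 mul0mx.
  exists (fun k => pinvmx (qpath M i j *m z) *m qpath M k j) => [k kj|k ikj].
    rewrite -mulmxA; congr (_ *m _).
    rewrite (@qpath_trans _ _ _ k k.+1); last lia.
    by rewrite (qpathS _ (leqnn k)) qpath_id mulmx1.
  rewrite -mulmxA (mulmxA (qpath M k j)) -qpath_trans //.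
  exact: mulVpmx_cV.
have [|d [p [q [pq MN]]]] :=
    @quiver_split M _ (line_in i j u) (line_on i j phi).
  by move=> k hk; apply: line_onK; apply: phiu.
pose M' := @QuiverRep K n d (fun a => p a.+2 *m qmap M a *m q a.+1).
exists M'; apply: quiver_iso_trans MN _.
exists (fun=> 1%:M), (fun=> 1%:M); split=> [k _|a]; first by rewrite !mulmx1.
rewrite mulmx1 mul1mx /=.
have [_ _ pv1 phiq1] := pq _ (arrow_source a).
have [_ _ pv2 phiq2] := pq _ (arrow_target a).
have [an1 an2] := (arrow_source a, arrow_target a).
congr block_mx; rewrite -arrE.
- have [a1|a1] := true_or_false (i <= a.+1 <= j)%N; last first.
    by apply: eq_mx_ncols0; rewrite a1.
  have [a2|a2] := true_or_false (i <= a.+2 <= j)%N; last first.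
    by apply: eq_mx_nrows0; rewrite a2.
  rewrite /line_on /line_in -!mulmxA (mulmxA (arr _ _)).
  rewrite (mulmxA (phi _)).
  rewrite uS ?phiu ?mul1mx //; last lia.
  apply/matrixP=> r c; rewrite !mxE big_ord1 !mxE.
  by rewrite mulr1.
- have [a2|a2] := true_or_false (i <= a.+2 <= j)%N; last first.
    by apply: eq_mx_nrows0; rewrite a2.
  have [ia|ia] : i = a.+2 \/ (i <= a.+1)%N by lia.
    by rewrite (@eq_mx_ncols0 _ _ _ (arr M a.+1) 0) ?mulmx0 ?mul0mx // M0 //; lia.
  rewrite /line_on -!mulmxA !(mulmxA (phi _)).
  rewrite phiS; last lia.
  have -> : (i <= a.+2 <= j)%N = (i <= a.+1 <= j)%N by lia.
  by rewrite mulmxA.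
- have [a1|a1] := true_or_false (i <= a.+1 <= j)%N; last first.
    by apply: eq_mx_ncols0; rewrite a1.
  rewrite /line_in -!mulmxA (mulmxA (arr _ _)) uS; last lia.
  have [aj|aj] : (a.+2 <= j)%N \/ a.+1 = j by lia.
    by have -> : (i <= a.+1 <= j)%N = (i <= a.+2 <= j)%N by lia.
  by rewrite aj uj1 mul0mx mulmx0.
Qed.

(** The endpoints are read off the path ranks, hence are common to all
    representations with the same path ranks. *)
Lemma first_summand_exists N :
  (exists2 k, (0 < k <= n)%N & qdim N k != 0%N) ->
  exists i j, [/\ (0 < i)%N, (i <= j <= n)%N,
    forall k, (0 < k < i)%N -> qdim N k = 0%N, (0 < rk N i j)%N &
    rk N i j.+1 = 0%N].
Proof.
move=> [k0 hk0 Nk0].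
have exI : exists i, (0 < i <= n)%N && (qdim N i != 0%N).
  by exists k0; rewrite hk0.
have [i /andP[hi Ni] imin] := ex_minnP exI.
have exJ : exists j, (i <= j <= n)%N && (0 < rk N i j)%N.
  by exists i; rewrite rk_id lt0n Ni; lia.
have ubJ j : (i <= j <= n)%N && (0 < rk N i j)%N -> (j <= n)%N by lia.
have [j /andP[hj rj] jmax] := ex_maxnP exJ ubJ.
exists i, j; split=> // [|k hk|]; first lia.
  by apply/eqP; apply: contraTT isT => Nk; have := imin k; rewrite Nk; lia.
apply/eqP; rewrite -leqn0 leqNgt; apply/negP=> rj1.
have [jn|jn] : j = n \/ (j < n)%N by lia.
  by move: rj1; rewrite jn rk_out //; lia.
by have := jmax j.+1; rewrite rj1; lia.
Qed.

Lemma quiver_iso_dsumr M N N' :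
  quiver_iso N N' -> quiver_iso (quiver_dsum M N) (quiver_dsum M N').
Proof.
move=> [f [g [fg fE]]].
exists (fun k => block_mx 1%:M 0 0 (f k)), (fun k => block_mx 1%:M 0 0 (g k)).
split=> [k /fg[h1 h2]|a] /=.
  by rewrite !mulmx_block !(mulmx0, mul0mx, addr0, add0r, mulmx1) h1 h2
    -!scalar_mx_block.
by rewrite !mulmx_block !(mulmx0, mul0mx, addr0, add0r, mulmx1, mul1mx) fE.
Qed.

Lemma rk_dsum_ind i j M a b : (0 < a)%N -> (a <= b <= n)%N ->
  rk (quiver_dsum (quiver_ind K n i j) M) a b =
  (((i <= a) && (b <= j)) + rk M a b)%N.
Proof. by move=> a0 abn; rewrite rk_dsum ?rk_ind //; lia. Qed.

Lemma qdim_sum_dsum_ind i j M : (0 < i)%N -> (i <= j <= n)%N ->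
  (\sum_(1 <= k < n.+1) qdim M k <
   \sum_(1 <= k < n.+1) qdim (quiver_dsum (quiver_ind K n i j) M) k)%N.
Proof.
move=> i0 ijn; rewrite /= big_split /= -[X in (X < _)%N]add0n ltn_add2r.
rewrite (@big_cat_nat _ _ _ i) //=; try lia.
by rewrite (@big_ltn _ _ _ i) ?leqnn //=; lia.
Qed.

Lemma qdim_iso M N k : quiver_iso M N -> (0 < k <= n)%N -> qdim M k = qdim N k.
Proof. by move=> MN hk; rewrite -!rk_id (rk_iso MN) //; lia. Qed.

Lemma qdim_sum_iso M N : quiver_iso M N ->
  (\sum_(1 <= k < n.+1) qdim M k = \sum_(1 <= k < n.+1) qdim N k)%N.
Proof. by move=> MN; apply: eq_big_nat => k hk; apply: qdim_iso. Qed.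

Lemma qdim_trivial_or N :
  (forall k, (0 < k <= n)%N -> qdim N k = 0%N) \/
  (exists2 k, (0 < k <= n)%N & qdim N k != 0%N).
Proof.
have [h|/hasPn h] := boolP (has (fun k => qdim N k != 0%N) (iota 1 n)).
  by right; case/hasP: h => k; rewrite mem_iota => hk Nk; exists k => //; lia.
by left=> k hk; apply/eqP; rewrite -[_ == _]negbK; apply: h; rewrite mem_iota; lia.
Qed.

(** Both representations split off the same interval by [split_first], and the
    remainders still have equal path ranks. *)
Theorem quiver_iso_of_rk M N :
  (forall a b, (0 < a)%N -> (a <= b <= n)%N -> rk M a b = rk N a b) ->
  quiver_iso M N.
Proof.
have [m] := ubnP (\sum_(1 <= k < n.+1) qdim N k)%N.
elim: m M N => // m IH M N Nm rkMN.
have dimMN k : (0 < k <= n)%N -> qdim M k = qdim N k.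
  by move=> hk; rewrite -!rk_id rkMN //; lia.
have [N0|/first_summand_exists [i [j [i0 ijn N0 rij rij1]]]] := qdim_trivial_or N.
  by apply: quiver_iso_dim0 => // k hk; rewrite dimMN // N0.
have [N' NN'] := split_first i0 ijn N0 rij rij1.
have [|||M' MM'] := @split_first M i j i0 ijn.
- by move=> k hk; rewrite dimMN ?N0 //; lia.
- by rewrite rkMN.
- have [jn|jn] : j = n \/ (j < n)%N by lia.
    by rewrite jn rk_out //; lia.
  by rewrite rkMN //; lia.
apply: (quiver_iso_trans MM'); apply: (quiver_iso_trans _ (quiver_iso_sym NN')).
apply/quiver_iso_dsumr/IH => [|a b a0 abn].
  have := @qdim_sum_dsum_ind _ _ N' i0 ijn.
  by rewrite -(qdim_sum_iso NN'); lia.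
have := rkMN a b a0 abn; rewrite (rk_iso MM') // (rk_iso NN') // !rk_dsum_ind //.
lia.
Qed.

End Splitting.

(** * Degenerations from path rank inequalities *)

(** Let [p(q)] be the least [p >= i] with [r p q = r' p q]. As long as [r] does
    not drop along the row [p(q)] from [q] to [q.+1], the sandwich
    [r p q.+1 <= r' p q.+1 <= r' p q = r p q = r p q.+1] forces
    [p(q.+1) <= p(q)]. So, starting from [p(s) <= s], the value [p(q)] weakly
    decreases until the first drop, which happens at [j] at the latest. *)
Lemma first_rank_drop (r r' : nat -> nat -> nat) (i s j : nat) :
    (i <= s <= j)%N ->
    (forall p q, (i <= p <= q)%N -> (q <= j)%N -> (r p q <= r' p q)%N) ->
    (forall p q, (i <= p <= q)%N -> (q <= j)%N -> (r' p q.+1 <= r' p q)%N) ->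
    (forall p, (i <= p <= j)%N -> (r p j.+1 < r' p j)%N) ->
    r s s = r' s s ->
  exists p q, [/\ (i <= p <= s)%N, (s <= q <= j)%N, (r p q.+1 < r p q)%N &
    forall p' q', (i <= p' < p)%N -> (s <= q' <= q)%N -> (r p' q' < r' p' q')%N].
Proof.
move=> isj le_rr' r'S rj rss.
(* The induction carries the minimality of [p] at all columns [s, ..., q] seen so
   far, where [p] is the least tight row of column [q]. *)
have main m q p : (q + m = j)%N -> (s <= q)%N -> (i <= p <= s)%N ->
    r p q = r' p q ->
    (forall p' q', (i <= p' < p)%N -> (s <= q' <= q)%N -> (r p' q' < r' p' q')%N) ->
    exists p q, [/\ (i <= p <= s)%N, (s <= q <= j)%N, (r p q.+1 < r p q)%N &
    forall p' q', (i <= p' < p)%N -> (s <= q' <= q)%N -> (r p' q' < r' p' q')%N].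
  elim: m q p => [|m IH] q p qm sq ips rpq below.
    have qj : q = j by lia.
    exists p, q; split=> //; first lia.
    by rewrite rpq qj; apply: rj; lia.
  have [drop|nodrop] := ltnP (r p q.+1) (r p q).
    by exists p, q; split=> //; lia.
  have eq1 : r p q.+1 = r' p q.+1.
    have := le_rr' p q.+1; have := r'S p q; lia.
  have exP : exists p', (i <= p' <= p)%N && (r p' q.+1 == r' p' q.+1).
    by exists p; rewrite eq1 eqxx; lia.
  have [p0 /andP[ip0 /eqP rp0] p0min] := ex_minnP exP.
  apply: (IH q.+1 p0) => //; [lia|lia|lia|] => p' q' ip' sq'.
  have [->|q'q] : q' = q.+1 \/ (q' <= q)%N by lia.
    rewrite ltn_neqAle le_rr' ?andbT; try lia.
    by apply/negP=> e; have := p0min p'; rewrite e; lia.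
  by apply: below; lia.
have exP : exists p', (i <= p' <= s)%N && (r p' s == r' p' s).
  by exists s; rewrite rss eqxx; lia.
have [p0 /andP[ip0 /eqP rp0] p0min] := ex_minnP exP.
apply: (main (j - s)%N s p0) => //; [lia|] => p' q' ip' sq'.
have -> : q' = s by lia.
rewrite ltn_neqAle le_rr' ?andbT; try lia.
by apply/negP=> e; have := p0min p'; rewrite e; lia.
Qed.

Section Degeneration.

Variables (K : fieldType) (n : nat).
Implicit Types M N : quiver_rep K n.

(** The vectors span a subrepresentation [S] of [M] supported on [i, ..., j], and
    the last clause says that passing to [M / S] lowers every path rank that
    attains the bound [r']. The interval is cut into pieces by
    [first_rank_drop]: on [s, ..., q] one takes the images of a single vector
    [z] from vertex [p <= s] that dies exactly after [q]. These lie in the image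
    of the path from [p'] for every [p' >= p], and for [p' < p] the bound is
    not attained. *)
Lemma line_subrep M (r' : nat -> nat -> nat) i j :
    (i <= j)%N ->
    (forall p q, (i <= p <= q)%N -> (q <= j)%N -> (rk M p q <= r' p q)%N) ->
    (forall p q, (i <= p <= q)%N -> (q <= j)%N -> (r' p q.+1 <= r' p q)%N) ->
    (forall p, (i <= p <= j)%N -> (rk M p j.+1 < r' p j)%N) ->
    (forall p, (i <= p <= j)%N -> rk M p p = r' p p) ->
  exists u : forall k, 'cV[K]_(qdim M k), forall k, (i <= k <= j)%N ->
    [/\ u k != 0,
        arr M k *m u k = 0 \/ (k < j)%N /\ arr M k *m u k = u k.+1 &
        forall p, (i <= p <= k)%N ->
          (rk M p k < r' p k)%N \/ exists z, u k = qpath M p k *m z].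
Proof.
move=> ij le_rr' r'S rj rss.
suff main m s : (s + m = j.+1)%N -> (i <= s)%N ->
    exists u : forall k, 'cV[K]_(qdim M k), forall k, (s <= k <= j)%N ->
    [/\ u k != 0,
        arr M k *m u k = 0 \/ (k < j)%N /\ arr M k *m u k = u k.+1 &
        forall p, (i <= p <= k)%N ->
          (rk M p k < r' p k)%N \/ exists z, u k = qpath M p k *m z].
  by apply: (main (j.+1 - i)%N); lia.
have [N] := ubnP m; elim: N m s => // N IH m s mN sm is_.
have [m0|m0] : m = 0%N \/ (0 < m)%N by lia.
  by exists (fun=> 0) => k; lia.
have isj : (i <= s <= j)%N by lia.
have [p [q [ips sqj drop below]]] :=
  first_rank_drop isj le_rr' r'S rj (rss s isj).
have [|||u uP] := IH (j - q)%N q.+1; [lia|lia|lia|].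
have [z zq zq1] : exists2 z : 'cV_(qdim M p), qpath M p q *m z != 0 &
    arr M q *m qpath M p q *m z = 0.
  by apply: rank_drop_kernel; rewrite -qpathS //; lia.
exists (fun k => if (k <= q)%N then qpath M p k *m z else u k) => k skj.
have [kq|qk] := leqP k q; last first.
  have [|u0 uS uim] := uP k; first lia.
  by have -> : (k < q)%N = false by lia.
split.
- apply: contraNneq zq => zk.
  by rewrite (@qpath_trans _ _ _ p k q) -?mulmxA ?zk ?mulmx0 //; lia.
- have [->|{}kq] : k = q \/ (k < q)%N by lia.
    by left; rewrite mulmxA.
  by right; rewrite kq mulmxA -qpathS; [split; [lia|]|lia].
- move=> p' ip'; have [p'p|pp'] := ltnP p' p; first by left; apply: below; lia.
  by right; exists (qpath M p p' *m z); rewrite mulmxA -qpath_trans //; lia.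
Qed.

Definition line_point w (x y : rep_space K n w) (t : K) : rep_space K n w :=
  fun a => x a + t *: (y a - x a).

(** An isomorphic copy of [M] is joined to one of [N] by a line on which no path
    rank exceeds that of [N]. Since path ranks are lower semicontinuous, all but
    finitely many points of such a line are then isomorphic to [N]. *)
Definition degenerates_to N M : Prop :=
  exists w (x y : rep_space K n w),
    [/\ quiver_iso (QuiverRep x) M, quiver_iso (QuiverRep y) N &
        forall t a b, (0 < a)%N -> (a <= b <= n)%N ->
          (rk (QuiverRep (line_point x y t)) a b <= rk N a b)%N].

Lemma qpath_block c d (S : rep_space K n c) (x : rep_space K n d)
    (E : forall a : 'I_n.-1, 'M[K]_(c a.+2, d a.+1)) i k :
    (0 < i)%N -> (i <= k <= n)%N ->
  exists S' E', qpath (@QuiverRep K n (fun k => c k + d k)%N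
      (fun a => block_mx (S a) (E a) 0 (x a))) i k =
    block_mx S' E' 0 (qpath (QuiverRep x) i k).
Proof.
move=> i0; elim: k => [|k IH] ikn; first lia.
have [->|ik] : i = k.+1 \/ (i <= k)%N by lia.
  by exists 1%:M, 0; rewrite !qpath_id -scalar_mx_block.
have [|S' [E' SE]] := IH; first lia.
have [|a ka] := @arrow_of n k; first lia.
subst k; exists (S a *m S'), (S a *m E' + E a *m qpath (QuiverRep x) i a.+1).
by rewrite !(qpathS _ ik) SE !arrE /= mulmx_block !(mul0mx, mulmx0, addr0, add0r).
Qed.

Lemma rk_block_le c d (S : rep_space K n c) (x : rep_space K n d)
    (E : forall a : 'I_n.-1, 'M[K]_(c a.+2, d a.+1)) i k :
    (0 < i)%N -> (i <= k <= n)%N ->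
  (rk (@QuiverRep K n (fun k => c k + d k)%N
      (fun a => block_mx (S a) (E a) 0 (x a))) i k
   <= c k + rk (QuiverRep x) i k)%N.
Proof.
move=> i0 ikn; rewrite /rk; have [S' [E' ->]] := qpath_block S x E i0 ikn.
rewrite block_mxEv -addsmxE; apply: (leq_trans (mxrank_adds_leqif _ _)).
by rewrite leq_add ?rank_leq_row // rank_row_0mx.
Qed.

Lemma quiver_iso_ext w (x y : rep_space K n w) :
  (forall a, x a = y a) -> quiver_iso (QuiverRep x) (QuiverRep y).
Proof.
move=> xy; exists (fun=> 1%:M), (fun=> 1%:M); split=> [i _|a] /=.
  by rewrite !mulmx1.
by rewrite mulmx1 mul1mx xy.
Qed.

(** The block form of [M] along the subrepresentation spanned by [u], with
    quotient [x]. A path rank drops in the quotient when the vector of the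
    target vertex lies in the image of the path, because that vector is
    killed. *)
Lemma line_quotient M i j (u : forall k, 'cV[K]_(qdim M k)) :
    (0 < i)%N -> (i <= j <= n)%N ->
    (forall k, (i <= k <= j)%N -> u k != 0) ->
    (forall k, (i <= k <= j)%N ->
       arr M k *m u k = 0 \/ (k < j)%N /\ arr M k *m u k = u k.+1) ->
  exists d (S : rep_space K n (fun k => (i <= k <= j)%N))
    (E : forall a : 'I_n.-1, 'M[K]_((i <= a.+2 <= j)%N, d a.+1))
    (x : rep_space K n d),
    [/\ quiver_iso M (@QuiverRep K n (fun k => (i <= k <= j) + d k)%N
          (fun a => block_mx (S a) (E a) 0 (x a))),
        forall a b, (0 < a)%N -> (a <= b <= n)%N ->
          (rk (QuiverRep x) a b <= rk M a b)%N &
        forall a b, (0 < a)%N -> (a <= b <= n)%N -> (i <= b <= j)%N ->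
          (exists z, u b = qpath M a b *m z) ->
          (rk (QuiverRep x) a b < rk M a b)%N].
Proof.
move=> i0 ijn u0 uS.
pose phi k := pinvmx (u k).
have [|d [p [q [pq MN]]]] :=
    @quiver_split _ _ M _ (line_in i j u) (line_on i j phi).
  by move=> k hk; apply: line_onK => ikj; apply/mulVpmx_cV/u0.
have pxv k : (0 < k < n)%N -> p k.+1 *m arr M k *m line_in i j u k = 0.
  move=> kn; have [ikj|ikj] := true_or_false (i <= k <= j)%N; last first.
    by apply: eq_mx_ncols0; rewrite ikj.
  rewrite /line_in -mulmxA (mulmxA (arr M k)).
  have [->|[kj ->]] := uS k ikj; first by rewrite mul0mx mulmx0.
  have [|_ _ pv _] := pq k.+1; first lia.
  by have -> : (i <= k <= j)%N = (i <= k.+1 <= j)%N by lia.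
have pu k : (i <= k <= j)%N -> p k *m u k = 0.
  move=> ikj; have [|_ _ pv _] := pq k; first lia.
  have -> : u k = line_in i j u k *m const_mx 1.
    rewrite /line_in -mulmxA ikj -[LHS]mulmx1; congr (_ *m _).
    by apply/matrixP=> r c; rewrite !mxE big_ord1 !mxE !ord1 mulr1.
  by rewrite mulmxA pv mul0mx.
pose x : rep_space K n d := fun a => p a.+2 *m qmap M a *m q a.+1.
have xE a b : (0 < a)%N -> (a <= b <= n)%N ->
    qpath (QuiverRep x) a b = p b *m qpath M a b *m q a.
  move=> a0 abn.
  apply: (@qpath_quotient _ _ M d p q _ (line_in i j u) (line_on i j phi)) => // k kn.
  by have [qpk pqk _ _] := pq k kn.
exists d, (fun a : 'I_n.-1 => line_on i j phi a.+2 *m qmap M a *m line_in i j u a.+1).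
exists (fun a : 'I_n.-1 => line_on i j phi a.+2 *m qmap M a *m q a.+1), x; split.
- apply: (quiver_iso_trans MN); apply: quiver_iso_ext => a.
  by congr block_mx; rewrite -arrE pxv //; case: (a) => /=; lia.
- move=> a b a0 abn; rewrite /rk xE //.
  exact: leq_trans (mxrankM_maxl _ _) (mxrankM_maxr _ _).
- move=> a b a0 abn ibj [z uz]; rewrite /rk xE //.
  apply: leq_ltn_trans (mxrankM_maxl _ _) _; apply: (kernel_rank_drop (z := z)).
    by rewrite -uz u0.
  by rewrite -mulmxA -uz pu.
Qed.

(** Split the interval [i, ..., j] off [N], with remainder [N'], and choose in
    [M] the subrepresentation of [line_subrep], whose quotient has path ranks
    bounded by those of [N']. By induction the quotient is joined to [N'] by a
    line. Keeping the block triangular shape and moving the diagonal blocks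
    along lines gives the line for [M] and [N]: a triangular block of dimension
    [c] adds at most [c] to a rank, and the interval contributes exactly that to
    the path ranks of [N]. *)
Theorem degenerates_of_rk_le M N :
    (forall k, (0 < k <= n)%N -> qdim M k = qdim N k) ->
    (forall a b, (0 < a)%N -> (a <= b <= n)%N -> (rk M a b <= rk N a b)%N) ->
  degenerates_to N M.
Proof.
have [m] := ubnP (\sum_(1 <= k < n.+1) qdim N k)%N.
elim: m M N => // m IH M N Nm dimMN rkMN.
have [N0|/first_summand_exists [i [j [i0 ijn N0 rij rij1]]]] := qdim_trivial_or N.
  exists (fun=> 0%N), (fun=> 0), (fun=> 0); split=> [||t a b a0 abn].
  - by apply: quiver_iso_dim0 => // k hk; rewrite dimMN ?N0.
  - exact: quiver_iso_dim0.
  - exact: leq_trans (rank_leq_row _) _.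
have [N' NN'] := split_first i0 ijn N0 rij rij1.
have rkN a b : (0 < a)%N -> (a <= b <= n)%N ->
    rk N a b = (((i <= a) && (b <= j)) + rk N' a b)%N.
  by move=> a0 abn; rewrite (rk_iso NN') // rk_dsum_ind.
have [||||| u uP] := @line_subrep M (rk N) i j.
- by lia.
- by move=> a b iab bj; apply: rkMN; lia.
- by move=> a b iab bj; apply: rkS; lia.
- move=> a iaj; have [jn|jn] : j = n \/ (j < n)%N by lia.
    by rewrite jn rk_out ?rkN; lia.
  have := rkMN a j.+1; have := @rkS _ _ N' a j; rewrite !rkN; lia.
- by move=> a iaj; rewrite !rk_id dimMN //; lia.
have [||d [S [E [x [Mx rkx rkx_lt]]]]] := @line_quotient M i j u i0 ijn.
- by move=> k /uP[].
- by move=> k /uP[].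
have [|||w [x1 [y1 [xx1 yy1 rk1]]]] := IH (QuiverRep x) N'.
- have := @qdim_sum_dsum_ind _ _ _ _ N' i0 ijn.
  by rewrite -(qdim_sum_iso NN'); lia.
- move=> k hk; have := qdim_iso Mx hk; rewrite dimMN // (qdim_iso NN') //=; lia.
- move=> a b a0 abn; have := rkMN a b a0 abn; rewrite rkN //.
  have := rkx a b a0 abn.
  have [iab|_] := boolP ((i <= a) && (b <= j))%N; last lia.
  have [|_ _ /(_ a) []] := uP b; [lia|lia| |].
    by rewrite rkN // iab; lia.
  by move=> h; have := rkx_lt a b a0 abn _ h; lia.
pose c k : nat := (i <= k <= j)%N.
have [f [g [fg fE]]] := xx1; rewrite /= in fg fE.
pose X : rep_space K n (fun k => c k + w k)%N :=
  fun a => block_mx (S a) (E a *m f a.+1) 0 (x1 a).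
pose Y : rep_space K n (fun k => c k + w k)%N :=
  qmap (quiver_dsum (quiver_ind K n i j) (QuiverRep y1)).
have NY : quiver_iso (QuiverRep Y) N.
  apply: (quiver_iso_trans _ (quiver_iso_sym NN')).
  exact: (quiver_iso_dsumr (quiver_ind K n i j) yy1).
exists (fun k => c k + w k)%N, X, Y; split=> //.
  apply: (quiver_iso_trans _ (quiver_iso_sym Mx)).
  exists (fun k => block_mx 1%:M 0 0 (f k)), (fun k => block_mx 1%:M 0 0 (g k)).
  split=> [k /fg[h1 h2]|a] /=.
    by rewrite !mulmx_block !(mulmx0, mul0mx, addr0, add0r, mulmx1) h1 h2
      -!scalar_mx_block.
  by rewrite !mulmx_block !(mulmx0, mul0mx, addr0, add0r, mulmx1, mul1mx) fE.
move=> t a b a0 abn.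
(* Only paths starting at or after [i] see the interval; everything vanishes
   before [i]. *)
have [ia|ai] := leqP i a; last first.
  apply: (leq_trans (rank_leq_col _)); rewrite /= -[X in (X <= _)%N]/(qdim (QuiverRep Y) a).
  by rewrite (qdim_iso NY) ?N0 //; lia.
pose S' a := S a + t *: (const_mx 1 - S a).
pose E' a := E a *m f a.+1 + t *: (0 - E a *m f a.+1).
pose Z : rep_space K n (fun k => c k + w k)%N :=
  fun a => block_mx (S' a) (E' a) 0 (line_point x1 y1 t a).
have -> : rk (QuiverRep (line_point X Y t)) a b = rk (QuiverRep Z) a b.
  apply: rk_iso => //; apply: quiver_iso_ext => e; rewrite /line_point /X /Y /=.
  rewrite opp_block_mx add_block_mx scale_block_mx add_block_mx.
  by rewrite !subr0 scaler0 addr0.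
apply: (leq_trans (rk_block_le _ _ _ a0 abn)).
rewrite rkN // leq_add ?rk1 //; rewrite /c ia; lia.
Qed.

End Degeneration.

(** * Path ranks in terms of arrays *)

Section ModelRank.

Variables (n : nat) (w : nat -> nat).
Implicit Types Y : tri_array n w.

(** The multiplicities telescope: they are differences of consecutive entries
    along a diagonal of the array. *)
Lemma sum_nu Y j m : (m <= j <= n)%N ->
  (\sum_(1 <= i < m.+1) nu Y i j = Y m (j - m + 1))%N.
Proof.
elim: m => [|m IH] mj; first by rewrite big_geq // entry_out.
rewrite big_nat_recr //= IH /nu /=; last lia.
have -> : (j - m.+1 + 2 = j - m + 1)%N by lia.
apply: subnKC; have [->|m0] := posnP m; first by rewrite entry_out.
have -> : (j - m + 1 = (j - m.+1 + 1).+1)%N by lia.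
by apply: (@entry_diag _ _ Y m.+1); rewrite /in_triangle; lia.
Qed.

(** The path from [a] to [b] has on [R_ij] the rank 1 if [i <= a] and [b <= j],
    and 0 otherwise. Summing [nu Y i j] over [i <= a] by [sum_nu] leaves the tail
    of row [a] of the array, the complement of the partial sum that enters the
    dominance order; this explains the reversal in that order. *)
Lemma rk_model (K : fieldType) Y a b : (0 < a)%N -> (a <= b <= n)%N ->
  (rk (model_rep K Y) a b + \sum_(1 <= k < (b - a).+1) Y a k = w a)%N.
Proof.
move=> a0 abn.
have rkD := big_morph (fun M => rk M a b)
  (fun M N => @rk_dsum K n M N a b ltac:(lia)) (rk_zero K n a b).
have -> : rk (model_rep K Y) a b = (\sum_(b <= j < n.+1) Y a (j - a + 1))%N.
  rewrite rkD (@big_cat_nat _ _ _ a.+1) //=; try lia.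
  rewrite [X in (_ + X)%N]big_nat [X in (_ + X)%N]big1 => [|i hi]; last first.
    rewrite rkD big_nat big1 // => j hj; rewrite rkD big1 // => k _.
    by rewrite rk_ind //; lia.
  rewrite addn0 big_nat.
  rewrite (eq_bigr (fun i => \sum_(b <= j < n.+1) nu Y i j)%N) => [|i hi].
    rewrite -big_nat exchange_big_nat; apply: eq_big_nat => j hj /=.
    by rewrite sum_nu //; lia.
  rewrite rkD (@big_cat_nat _ _ _ b) //=; try lia.
  rewrite big_nat big1 ?add0n => [|j hj]; last first.
    by rewrite rkD big1 // => k _; rewrite rk_ind //; lia.
  apply: eq_big_nat => j hj; rewrite rkD.
  rewrite (eq_bigr (fun=> 1%N)) => [|k _]; last by rewrite rk_ind //; lia.
  by rewrite sum1_card card_ord.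
have hw := @entry_sum _ _ Y a; rewrite -hw; last lia.
rewrite [RHS](@big_cat_nat _ _ _ (b - a).+1) //=; try lia.
rewrite addnC; congr (_ + _)%N.
have -> : b = ((b - a).+1 + (a - 1))%N by lia.
rewrite big_addn; have -> : ((b - a).+1 + (a - 1) - a = b - a)%N by lia.
have -> : (n.+1 - (a - 1) = (n - a + 1).+1)%N by lia.
by apply: eq_big_nat => k hk; congr (Y a _); lia.
Qed.

Lemma qdim_model (K : fieldType) Y k : (0 < k <= n)%N -> qdim (model_rep K Y) k = w k.
Proof.
move=> hk; rewrite -(@rk_model K Y k k) ?rk_id; try lia.
by rewrite subnn big_geq ?addn0.
Qed.

Lemma chute_le_rk (K : fieldType) Y Y' :
  chute_le Y Y' <->
  (forall a b, (0 < a)%N -> (a <= b <= n)%N ->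
    (rk (model_rep K Y) a b <= rk (model_rep K Y') a b)%N).
Proof.
split=> [le_YY' a b a0 abn|le_rk i j /and3P[i1 j1 ijn]].
  have := rk_model K Y a0 abn; have := rk_model K Y' a0 abn.
  have [->|ab] : b = a \/ (a < b)%N by lia.
    by rewrite subnn !big_geq //; lia.
  have := le_YY' a (b - a)%N; rewrite /in_triangle; lia.
(* A full row sums to [w i] in both arrays; it corresponds to no path. *)
have [ijn'|ijn'] : (i + j = n.+1)%N \/ (i + j <= n)%N by lia.
  have -> : j = (n - i + 1)%N by lia.
  by rewrite !entry_sum //; lia.
have := le_rk i (i + j)%N i1.
have := @rk_model K Y i (i + j) i1; have := @rk_model K Y' i (i + j) i1.
rewrite addKn; lia.
Qed.

End ModelRank.

(** * Path ranks and lines as polynomial data *)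

Section Polynomials.

Variables (K : fieldType) (n : nat) (w : nat -> nat).
Implicit Types x y : rep_space K n w.

Local Notation coords x := (fun k => Defs.coord x (enum_val k)).

Lemma qpath_polynomial a b :
  exists P : 'M[{mpoly K[#|coord_type n w|]}]_(w b, w a),
    forall x, map_mx (meval (coords x)) P = qpath (QuiverRep x) a b.
Proof.
elim: b => [|b [P PE]].
  have [->|a0] := posnP a.
    by exists 1%:M => x; rewrite qpath_id map_mx1.
  by exists 0 => x; rewrite map_mx0 /= gtn_eqF.
have [ab|ab] := eqVneq a b.+1.
  by rewrite ab; exists 1%:M => x; rewrite qpath_id map_mx1.
have [arrP arrPE] : exists P : 'M[{mpoly K[#|coord_type n w|]}]_(w b.+1, w b),
    forall x, map_mx (meval (coords x)) P = arr (QuiverRep x) b.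
  case: (b) => [|e]; first by exists 0 => x; rewrite map_mx0.
  rewrite /=; case: eqP => [he|_]; last by exists 0 => x; rewrite map_mx0.
  pose e' : 'I_n.-1 := Ordinal he.
  exists (\matrix_(r < w e'.+2, c < w e'.+1) 'X_(enum_rank
    (Tagged (fun a : 'I_n.-1 => ('I_(w a.+2) * 'I_(w a.+1))%type) (r, c)))).
  by move=> x; apply/matrixP=> r c; rewrite !mxE mevalXU enum_rankK.
exists (arrP *m P) => x; rewrite map_mxM /= PE arrPE.
by rewrite (negbTE ab).
Qed.

(** Factoring the path map of [x] through its rank [s] gives constant matrices
    [L], [R] with [L *m _ *m R] the identity of size [s]; the polynomial is the
    determinant of [L *m _ *m R]. *)
Lemma rk_polynomial x a b :
  exists q : {mpoly K[#|coord_type n w|]}, q.@[coords x] != 0 /\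
    forall y, (rk (QuiverRep y) a b < rk (QuiverRep x) a b)%N ->
      q.@[coords y] = 0.
Proof.
have [P PE] := qpath_polynomial a b.
pose A := qpath (QuiverRep x) a b.
pose L := pinvmx (col_base A); pose R := pinvmx (row_base A).
have LAR : L *m A *m R = 1%:M.
  rewrite -[X in L *m X]mulmx_base mulmxA mulVpmx ?col_base_full // mul1mx.
  by rewrite mulmxVp ?row_base_free.
pose cst m p (B : 'M[K]_(m, p)) := map_mx (@mpolyC #|coord_type n w| K) B.
have evq y : (\det (cst _ _ L *m P *m cst _ _ R)).@[coords y] =
    \det (L *m qpath (QuiverRep y) a b *m R).
  rewrite -det_map_mx !map_mxM PE /cst -!map_mx_comp.
  by congr (\det (_ *m _ *m _)); apply/matrixP=> r c; rewrite !mxE /= mevalC.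
exists (\det (cst _ _ L *m P *m cst _ _ R)); split.
  by rewrite evq LAR det1 oner_eq0.
move=> y lt_rk; rewrite evq; apply/eqP; apply: contraTT lt_rk => detN0.
rewrite -leqNgt.
apply: (@leq_trans (\rank (L *m qpath (QuiverRep y) a b *m R))).
  by rewrite mxrank_unit // unitmxE unitfE.
exact: leq_trans (mxrankM_maxl _ _) (mxrankM_maxr _ _).
Qed.

(** Path ranks are lower semicontinuous: [q] cuts out an open neighbourhood of
    [x] on which none of them drops. *)
Lemma rk_polynomial_all x :
  exists q : {mpoly K[#|coord_type n w|]}, q.@[coords x] != 0 /\
    forall y, q.@[coords y] != 0 ->
      forall a b, (a <= n)%N -> (b <= n)%N ->
      (rk (QuiverRep x) a b <= rk (QuiverRep y) a b)%N.
Proof.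
have ex_q (ab : 'I_n.+1 * 'I_n.+1) := rk_polynomial x ab.1 ab.2.
have [q qP] := boolp.choice ex_q.
exists (\prod_ab q ab); split.
  rewrite rmorph_prod; apply/prodf_neq0 => ab _; exact: (qP ab).1.
move=> y; rewrite rmorph_prod => /prodf_neq0 qy a b an bn.
rewrite leqNgt; apply/negP => lt_rk.
have hab := qy (inord a, inord b) isT.
by move/eqP: hab; apply; apply: (qP _).2; rewrite /= !inordK.
Qed.

Lemma mpoly_on_line x y (p : {mpoly K[#|coord_type n w|]}) :
  exists P : {poly K}, forall t, P.[t] = p.@[coords (line_point x y t)].
Proof.
pose l (k : 'I_#|coord_type n w|) : {poly K} := (Defs.coord x (enum_val k))%:P +
  (Defs.coord y (enum_val k) - Defs.coord x (enum_val k)) *: 'X.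
exists (\sum_(m <- msupp p) p@_m *: \prod_i l i ^+ m i) => t.
rewrite mevalE horner_sum; apply: eq_bigr => m _.
rewrite hornerZ horner_prod; congr (_ * _); apply: eq_bigr => i _.
rewrite horner_exp hornerD hornerC hornerZ hornerX mulrC.
by rewrite /Defs.coord /line_point !mxE.
Qed.

End Polynomials.

Lemma poly_eq0_on_num (K : numFieldType) (P : {poly K}) :
  (forall t, P.[t] = 0) -> P = 0.
Proof.
move=> P0; apply/eqP; apply: contraT => PN0.
have := @max_poly_roots _ P [seq i%:R | i <- iota 0 (size P)] PN0.
rewrite size_map size_iota ltnn => -> //.
  by apply/allP=> z _; rewrite /root P0.
rewrite map_inj_uniq ?iota_uniq // => i j /eqP.
by rewrite eqr_nat => /eqP.
Qed.

(** * Orbit closures *)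

Section OrbitClosure.

Variables (n : nat) (w : nat -> nat).
Implicit Types Y : tri_array n w.

Lemma zariski_closureP (K : fieldType) (S : set (rep_space K n w)) x :
  zariski_closure S x <->
  forall p : {mpoly K[#|coord_type n w|]},
    (forall y, S y -> p.@[fun k => Defs.coord y (enum_val k)] = 0) ->
    p.@[fun k => Defs.coord x (enum_val k)] = 0.
Proof.
split=> [Sx p p0|xp Z [[I ->] SZ] p Ip]; last first.
  by apply: xp => y /SZ; apply.
apply: (Sx [set y | forall q, [set p]%classic q ->
    q.@[fun k => Defs.coord y (enum_val k)] = 0]%classic); last by [].
split; first by exists [set p]%classic.
by move=> y /p0 py q ->.
Qed.

Lemma orbit_rkP (K : fieldType) Y (x : rep_space K n w) :
  orbit_of K Y x <->
  (forall a b, (0 < a)%N -> (a <= b <= n)%N ->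
    rk (QuiverRep x) a b = rk (model_rep K Y) a b).
Proof.
split=> [xY a b a0 abn|]; first exact: rk_iso.
exact: quiver_iso_of_rk.
Qed.

Lemma quiver_iso_conj (K : fieldType) (M : quiver_rep K n) (e : nat -> nat)
    (f : forall k, 'M[K]_(e k, qdim M k)) (g : forall k, 'M[K]_(qdim M k, e k)) :
    (forall k, (0 < k <= n)%N -> f k *m g k = 1%:M /\ g k *m f k = 1%:M) ->
  quiver_iso M (@QuiverRep K n e (fun a => f a.+2 *m qmap M a *m g a.+1)).
Proof.
move=> fg; exists f, g; split=> // a /=; have [_ gf] := fg _ (arrow_source a).
by rewrite -!mulmxA gf mulmx1.
Qed.

Lemma orbit_nonempty (K : fieldType) Y : exists x, orbit_of K Y x.
Proof.
pose f k : 'M[K]_(w k, qdim (model_rep K Y) k) := pid_mx (w k).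
pose g k : 'M[K]_(qdim (model_rep K Y) k, w k) := pid_mx (w k).
exists (fun a : 'I_n.-1 => f a.+2 *m qmap (model_rep K Y) a *m g a.+1).
apply/quiver_iso_sym/quiver_iso_conj => k hk; rewrite /f /g.
by move: (qdim_model K Y hk) => e; rewrite e !pid_mx_1 mulmx1.
Qed.

(** Otherwise [rk_polynomial] at a point of the first orbit gives a polynomial that
    vanishes on the second orbit but not at that point. *)
Lemma rk_le_of_geom_le (K : fieldType) Y Y' : geom_le K Y Y' ->
  forall a b, (0 < a)%N -> (a <= b <= n)%N ->
    (rk (model_rep K Y) a b <= rk (model_rep K Y') a b)%N.
Proof.
move=> le_YY' a b a0 abn; have [x xY] := orbit_nonempty K Y.
have [q [qx q0]] := rk_polynomial x a b.
rewrite -(orbit_rkP Y x).1 // leqNgt; apply/negP => lt_rk.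
case/negP: qx; apply/eqP; move: (le_YY' x xY) => /zariski_closureP; apply.
by move=> y /orbit_rkP yY'; apply: q0; rewrite yY'.
Qed.

(** Let [p] vanish on the orbit of [Y']. On the line from [x] to a point [y] of
    that orbit, the product of [p] with the polynomial [q] of
    [rk_polynomial_all] at [y] is zero: where [q] is nonzero the path ranks are
    exactly those of [Y'], so the point is in the orbit. Since [q] is not
    identically zero on the line, [p] is, and in particular it vanishes at
    [x]. *)
Lemma geom_le_of_rk_le (K : numFieldType) Y Y' :
    (forall a b, (0 < a)%N -> (a <= b <= n)%N ->
      (rk (model_rep K Y) a b <= rk (model_rep K Y') a b)%N) ->
  geom_le K Y Y'.
Proof.
move=> le_rk x xY; apply/zariski_closureP => p p0.
have [||w0 [x0 [y0 [xx0 yy0 rk0]]]] :=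
    @degenerates_of_rk_le K n (QuiverRep x) (model_rep K Y').
- by move=> k hk; rewrite qdim_model.
- by move=> a b a0 abn; rewrite (orbit_rkP Y x).1 ?le_rk.
have [f [g [fg fE]]] := xx0; rewrite /= in f g fg fE.
pose y : rep_space K n w := fun a => f a.+2 *m y0 a *m g a.+1.
have yY' : orbit_of K Y' y.
  by apply: quiver_iso_trans yy0; apply/quiver_iso_sym/(@quiver_iso_conj _ (QuiverRep y0)).
have lineE t : line_point x y t =
    fun a => f a.+2 *m line_point x0 y0 t a *m g a.+1.
  apply: boolp.functional_extensionality_dep => a; rewrite /line_point.
  have -> : x a = f a.+2 *m x0 a *m g a.+1.
    have [h _] := fg _ (arrow_source a).
    by rewrite fE -mulmxA h mulmx1.
  by rewrite /y -mulmxBl -mulmxBr scalemxAl scalemxAr -mulmxDl -mulmxDr.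
have rk_line t a b : (0 < a)%N -> (a <= b <= n)%N ->
    (rk (QuiverRep (line_point x y t)) a b <= rk (model_rep K Y') a b)%N.
  move=> a0 abn; apply: leq_trans (rk0 t a b a0 abn); rewrite lineE.
  by rewrite (rk_iso (@quiver_iso_conj _ (QuiverRep (line_point x0 y0 t)) _ _ _ fg)).
have [q [qy rk_q]] := rk_polynomial_all y.
have [P PE] := mpoly_on_line x y p; have [Q QE] := mpoly_on_line x y q.
have line0 : line_point x y 0 = x.
  by apply: boolp.functional_extensionality_dep => a; rewrite /line_point scale0r addr0.
have line1 : line_point x y 1 = y.
  by apply: boolp.functional_extensionality_dep => a; rewrite /line_point scale1r subrKC.
have QN0 : Q != 0.
  by apply: contraNneq qy => Q0; rewrite -line1 -QE Q0 horner0.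
have /eqP : P * Q = 0.
  apply: poly_eq0_on_num => t; rewrite hornerM.
  have [->|Qt] := eqVneq Q.[t] 0; first by rewrite mulr0.
  rewrite PE p0 ?mul0r //; apply/orbit_rkP => a b a0 abn.
  apply/eqP; rewrite eqn_leq rk_line //=.
  by rewrite -(orbit_rkP Y' y).1 // rk_q -?QE //; lia.
rewrite mulf_eq0 (negbTE QN0) orbF => /eqP P0.
by rewrite -line0 -PE P0 horner0.
Qed.

End OrbitClosure.

Theorem theorem3p3 (R : realType) (n : nat) (hn : (1 <= n)%N) (w : nat -> nat)
    (Y Y' : tri_array n w) :
  chute_le Y Y' <-> geom_le R[i] Y Y'.
Proof.
rewrite (chute_le_rk R[i]); split; first exact: geom_le_of_rk_le.
exact: rk_le_of_geom_le.
Qed.
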